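(* Let $d\ge 1$ be an integer. For positive integers $k$ define $A_d(k)=k$ if $k\leq d+1$ and $A_d(k)=d\binom{k-1}{d}+1$ if $k>d+1$, and define $B_d(k)=k(A_d(k)-1)+1$. Let $F=\{X_1,\dots,X_m\}$ be a family of finite sets in $\mathbb{R}^d$. If \[\varphi\Big(\bigcup_{i\in I}X_i\Big)\geq B_d(|I|)\] for every non-empty subset $I\subset\{1,\dots,m\}$, then $F$ has a system of general position representatives.
   Context: A subset $X\subset\mathbb{R}^d$ is in general position if every subset of $X$ of size at most $d+1$ is affinely independent. For a finite set $X\subset\mathbb{R}^d$, $\varphi(X)$ denotes the maximal size of a subset of $X$ in general position. A system of general position representatives of $F=\{X_1,\dots,X_m\}$ is a set $\{x_1,\dots,x_m\}$ in general position with $x_i\in X_i$ for all $i$. *)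

(* Defs.v *)
From HB Require Import structures.
From mathcomp Require Export all_boot all_order all_algebra finmap.
From mathcomp Require Export boolp classical_sets reals.

Set Implicit Arguments.
Unset Strict Implicit.
Unset Printing Implicit Defensive.

Import GRing.Theory Num.Theory.

Local Open Scope fset_scope.
Local Open Scope classical_set_scope.
Local Open Scope ring_scope.

Section GeneralPosition.
Variables (R : realType) (d : nat).
Implicit Types (S X Y : {fset 'rV[R]_d}).

Definition affinely_independent S : Prop :=
  forall c : 'rV[R]_d -> R,
    \sum_(x <- S) c x = 0 -> \sum_(x <- S) c x *: x = 0 ->
    forall x, x \in S -> c x = 0.

Definition general_position (X : set 'rV[R]_d) : Prop :=
  forall S, [set` S] `<=` X -> (#|` S| <= d.+1)%N -> affinely_independent S.

Definition phi X : nat :=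
  (\max_(Y <- fpowerset X | `[< general_position [set` Y] >]) #|` Y|)%N.

(* Injectivity of [x] expresses that the representatives x_1, ..., x_m are m
   distinct points, as for systems of distinct representatives; without it the
   set {x_1, ..., x_m} could collapse to fewer points. *)
Definition is_gp_representatives m (X : 'I_m -> {fset 'rV[R]_d})
    (x : 'I_m -> 'rV[R]_d) : Prop :=
  [/\ injective x, forall i, x i \in X i & general_position (range x)].

Definition has_gp_representatives m (X : 'I_m -> {fset 'rV[R]_d}) : Prop :=
  exists x, is_gp_representatives X x.

End GeneralPosition.

Definition gpA (d k : nat) : nat :=
  if (k <= d.+1)%N then k else (d * 'C(k.-1, d)).+1.

(* gpA d k > 0 for k > 0, so the predecessor is the true A_d(k) - 1. *)
Definition gpB (d k : nat) : nat := (k * (gpA d k).-1).+1.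

(* Main.v *)
(** In homogeneous coordinates [y |-> (1, y)] affine independence becomes linear
independence, so general position in dimension [d] means that any [d + 1] of
the vectors [(1, y)] are linearly independent.

By pigeonhole, [B_d(k)] points in general position inside a union of [k] sets
leave [A_d(k)] of them in a single set. Removing such a set and iterating orders
the family so that the [k]-th set contains [A_d(k)] points in general position.
Representatives are then chosen greedily in that order: with
[t = min(d, k - 1)], the [k - 1] vectors already chosen have ['C(k - 1, t)]
subfamilies of size [t], the span of each contains at most [t] vectors of a set
in general position, and [A_d(k) = t * 'C(k - 1, t) + 1]. *)
Require Import Defs.
(* Required again so that the names and notations of finite sets take precedence
   over those of [classical_sets]. *)
From mathcomp Require Import fintype finset.

Set Implicit Arguments.
Unset Strict Implicit.
Unset Printing Implicit Defensive.

Import GRing.Theory.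
Local Open Scope ring_scope.

Lemma pigeonhole_cover (L I : finType) (P : {set L}) (K : {set I})
    (C : I -> pred L) n :
  (forall l, l \in P -> exists2 i, i \in K & C i l) ->
  (#|K| * n < #|P|)%N ->
  exists2 i, i \in K & (n < #|[set l in P | C i l]|)%N.
Proof.
move=> coverP ltP; apply/exists_inP; apply: contraLR ltP.
rewrite negb_exists_in -leqNgt => /forall_inP smallC.
have cardC i : #|[set l in P | C i l]| = (\sum_(l in P) C i l)%N.
  by rewrite -sum1dep_card big_mkcondr.
apply: (@leq_trans (\sum_(i in K) #|[set l in P | C i l]|)%N).
  under eq_bigr do rewrite cardC.
  rewrite exchange_big -sum1_card leq_sum // => l /coverP[i iK Cil].
  by rewrite (bigD1 i) //= Cil.
by rewrite -sum_nat_const leq_sum // => i /smallC; rewrite -leqNgt.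
Qed.

Lemma subset_card_between (I : finType) (A B : {set I}) n :
  A \subset B -> (#|A| <= n <= #|B|)%N ->
  exists C : {set I}, [/\ A \subset C, C \subset B & #|C| = n].
Proof.
move=> subAB /andP[leAn lenB].
have : (0 < #|[set D : {set I} | D \subset B :\: A & #|D| == n - #|A|]|)%N.
  by rewrite cards_draws bin_gt0 cardsDS // leq_sub2r.
case/card_gt0P => D.
rewrite inE subsetD => /andP[/andP[subDB disjDA] /eqP cardD].
exists (A :|: D); split; [exact: subsetUl | by rewrite subUset subAB |].
have [_ +] := leq_card_setU A D.
by rewrite disjoint_sym disjDA cardD subnKC // => /eqP.
Qed.

Lemma gpAS n k : gpA n k.+1 = (minn n k * 'C(k, minn n k)).+1.
Proof. by rewrite /gpA /= ltnS; case: leqP => // _; rewrite binn muln1. Qed.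

Section NwiseFree.
Variables (F : fieldType) (V : vectType F).

Lemma free_mapP (T : eqType) (h : T -> V) (s : seq T) : uniq s ->
  free (map h s) <->
  (forall c : T -> F, \sum_(z <- s) c z *: h z = 0 ->
    forall z, z \in s -> c z = 0).
Proof.
move=> uniq_s; rewrite -[s in map h s]in_tupleE.
have sum_tnth (c : T -> F) : \sum_(z <- s) c z *: h z =
    \sum_(i < size s) c (tnth (in_tuple s) i) *: (map_tuple h (in_tuple s))`_i.
  by rewrite big_tnth; apply: eq_bigr => i _; rewrite -tnth_nth tnth_map.
split=> [/freeP free_s c | indep_s].
  rewrite sum_tnth => /free_s c0 z /(tnthP (in_tuple s))[i ->]; exact: c0.
apply/freeP => k k0 i.
pose c z := if insub (index z s) is Some j then k j else 0.
have cE j : c (tnth (in_tuple s) j) = k j.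
  by rewrite /c (tnth_nth (tnth (in_tuple s) i)) index_uniq // valK.
rewrite -cE indep_s ?mem_tnth // -[RHS]k0 sum_tnth.
by apply: eq_bigr => j _; rewrite cE.
Qed.

Definition nwise_free n (I : finType) (v : I -> V) (K : {set I}) : Prop :=
  forall J : {set I}, J \subset K -> (#|J| <= n)%N -> free (image v J).

Lemma nwise_freeS n (I : finType) (v : I -> V) (K K' : {set I}) :
  K' \subset K -> nwise_free n v K -> nwise_free n v K'.
Proof. by move=> subK' vK J /subset_trans/(_ subK'); apply: vK. Qed.

Lemma eq_nwise_free n (I : finType) (v v' : I -> V) (K : {set I}) :
  {in K, v =1 v'} -> nwise_free n v K -> nwise_free n v' K.
Proof.
move=> vv' vK J subJ /(vK J subJ).
suff -> : image v J = image v' J by [].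
by apply/eq_in_map => i; rewrite mem_enum => /(subsetP subJ)/vv'.
Qed.

Lemma nwise_free_inj n (I : finType) (v : I -> V) (K : {set I}) :
  (1 < n)%N -> nwise_free n v K -> {in K &, injective v}.
Proof.
move=> n_gt1 vK i j iK jK; have /dinjectiveP : uniq (image v [set i; j]).
  apply/free_uniq/vK; first by rewrite subUset !sub1set iK.
  by rewrite cards2 (leq_trans _ n_gt1) // ltnS leq_b1.
by apply; rewrite ?set21 ?set22.
Qed.

Lemma nwise_free_card_vspace n (I : finType) (v : I -> V) (K : {set I})
    (U : {vspace V}) :
  nwise_free n v K -> (\dim U < n)%N ->
  (#|[set i in K | v i \in U]| <= \dim U)%N.
Proof.
move=> vK ltUn; rewrite leqNgt; apply/negP => ltUK.
have [|J [_ /subsetP subJ cardJ]] :=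
    @subset_card_between _ _ _ (\dim U).+1 (sub0set [set i in K | v i \in U]).
  by rewrite cards0 ltUK.
have : free (image v J).
  apply: vK; rewrite ?cardJ //.
  by apply/subsetP => i /subJ; rewrite inE => /andP[].
have : (<<image v J>> <= U)%VS.
  apply/span_subvP => _ /imageP[i /subJ + ->].
  by rewrite inE => /andP[].
by move=> /dimvS + /eqP dimJ; rewrite dimJ size_image cardJ ltnn.
Qed.

Lemma nwise_freeU1 n (I : finType) (v : I -> V) (K : {set I}) i :
  nwise_free n.+1 v K ->
  (forall J : {set I}, J \subset K -> (#|J| <= n)%N ->
     v i \notin <<image v J>>%VS) ->
  nwise_free n.+1 v (i |: K).
Proof.
move=> vK vi J; rewrite -subDset => subJ leJ.
have [iJ | iNJ] := boolP (i \in J); last first.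
  by apply: vK => //; apply: subset_trans subJ; rewrite subsetD1 subxx.
rewrite (cardsD1 i) iJ in leJ.
have /perm_free -> : perm_eq (image v J) (v i :: image v (J :\ i)).
  rewrite -map_cons perm_map // uniq_perm ?enum_uniq //=.
    by rewrite enum_uniq mem_enum setD11.
  by move=> j; rewrite inE !mem_enum in_setD1; case: eqVneq => // ->.
by rewrite free_cons vi // vK // ltnW.
Qed.

Lemma exists_notin_vspaces n t (L I : finType) (w : L -> V) (P : {set L})
    (K : {set I}) (U : I -> {vspace V}) :
  nwise_free n w P -> (t < n)%N -> {in K, forall i, (\dim (U i) <= t)%N} ->
  (#|K| * t < #|P|)%N ->
  exists2 l, l \in P & {in K, forall i, w l \notin U i}.
Proof.
move=> wP lttn dimU ltP; apply: contrapT => meets.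
have [l lP||i iK] := @pigeonhole_cover _ _ P K (fun i l => w l \in U i) t.
- apply: contrapT => avoid; apply: meets; exists l => // i iK.
  by apply/negP => wlU; apply: avoid; exists i.
- exact: ltP.
rewrite ltnNge => /negP; apply; apply: leq_trans (dimU i iK).
exact: nwise_free_card_vspace wP (leq_ltn_trans (dimU i iK) lttn).
Qed.

(* It suffices to avoid the spans of the subfamilies of the maximal size
   [minn n #|K|]: every smaller subfamily is contained in one of those. *)
Lemma exists_notin_spans n (I L : finType) (v : I -> V) (K : {set I})
    (w : L -> V) (P : {set L}) :
  nwise_free n.+1 w P -> (gpA n #|K|.+1 <= #|P|)%N ->
  exists2 l, l \in P & forall J : {set I}, J \subset K -> (#|J| <= n)%N ->
    w l \notin <<image v J>>%VS.
Proof.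
move=> wP; rewrite gpAS; set t := minn n #|K| => ltP.
pose maxJ := [set J : {set I} | J \subset K & #|J| == t].
have [|J||l lP avoid] := @exists_notin_vspaces n.+1 t _ _ w P maxJ
    (fun J => <<image v J>>%VS) wP.
- by rewrite ltnS geq_minl.
- by rewrite inE => /andP[_ /eqP <-]; rewrite -(size_image v) dim_span.
- by rewrite cards_draws mulnC.
exists l => // J subJ leJ.
have [|J' [subJJ' subJ' cardJ']] := subset_card_between (n := t) subJ.
  by rewrite leq_min leJ subset_leq_card //= geq_minr.
have /avoid : J' \in maxJ by rewrite inE subJ' cardJ' eqxx.
apply: contra; apply: subvP; apply: sub_span => _ /imageP[i iJ ->].
by rewrite image_f // (subsetP subJJ').
Qed.

Lemma nwise_free_extend n (I L : finType) (v : I -> V) (K : {set I}) i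
    (w : L -> V) (P : {set L}) :
  i \notin K -> nwise_free n.+1 v K -> nwise_free n.+1 w P ->
  (gpA n #|K|.+1 <= #|P|)%N ->
  exists2 l, l \in P & nwise_free n.+1 [eta v with i |-> w l] (i |: K).
Proof.
move=> iNK vK wP leP; have [l lP avoid] := exists_notin_spans v wP leP.
have vE : {in K, v =1 [eta v with i |-> w l]}.
  by move=> j jK /=; case: eqP => // ji; rewrite -ji jK in iNK.
exists l => //; apply: nwise_freeU1; first exact: eq_nwise_free vK.
move=> J subJ leJ; rewrite /= eqxx.
have <- : image v J = image [eta v with i |-> w l] J.
  by apply/eq_in_map => j; rewrite mem_enum => /(subsetP subJ)/vE.
exact: avoid.
Qed.

Section Representatives.
Variables (n : nat) (T : choiceType) (h : T -> V) (I : finType).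
Variable X : I -> {fset T}.
Hypothesis large_union : forall K : {set I}, K != set0 -> exists Y : {fset T},
  [/\ (Y `<=` \bigcup_(i in K) X i)%fset,
      nwise_free n.+1 (h \o val : Y -> V) setT
    & (gpB n #|K| <= #|` Y|)%N].

Lemma exists_large_member (K : {set I}) : K != set0 ->
  exists2 i, i \in K & exists (Y : {fset T}) (P : {set Y}),
    [/\ {in P, forall z, val z \in X i},
        nwise_free n.+1 (h \o val : Y -> V) P & (gpA n #|K| <= #|P|)%N].
Proof.
move=> K0; have [Y [/fsubsetP YX hY leY]] := large_union K0.
have [z _||i iK ltP] := @pigeonhole_cover Y I setT K (fun i z => val z \in X i)
    (gpA n #|K|).-1.
- by have /bigfcupP[i /andP[_ iK] zXi] := YX _ (valP z); exists i.
- by rewrite cardsT -cardfE.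
exists i => //; exists Y, [set z in setT | val z \in X i]; split.
- by move=> z; rewrite inE => /andP[].
- exact: nwise_freeS (subsetT _) hY.
- exact: leq_trans (leqSpred _) ltP.
Qed.

Lemma exists_representatives : exists x : I -> T, forall i, x i \in X i.
Proof.
have [i|x xX] := @fin_all_exists I (fun=> T) (fun i z => z \in X i);
  last by exists x.
have [|_ /set1P-> [Y [P [PX _ leP]]]] := @exists_large_member [set i].
  by rewrite -card_gt0 cards1.
have /card_gt0P[z zP] : (0 < #|P|)%N by rewrite (leq_trans _ leP) // cards1.
by exists (val z); apply: PX.
Qed.

Lemma exists_nwise_free_representatives (K : {set I}) : exists x : I -> T,
  (forall i, x i \in X i) /\ nwise_free n.+1 (h \o x) K.
Proof.
move cardK: #|K| => k; elim: k K cardK => [|k IHk] K cardK.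
  have [x xX] := exists_representatives; exists x; split=> // J.
  rewrite (cards0_eq cardK) subset0 => /eqP -> _.
  by rewrite /image_mem enum_set0 nil_free.
have [|i iK [Y [P [PX hP]]]] := @exists_large_member K.
  by rewrite -card_gt0 cardK.
have cardKi : #|K :\ i| = k.
  by apply: succn_inj; rewrite -cardK (cardsD1 i K) iK.
rewrite cardK -cardKi => leP; have [x [xX hx]] := IHk _ cardKi.
have iNKi : i \notin K :\ i by rewrite setD11.
have [z zP hxz] := nwise_free_extend iNKi hx hP leP.
exists [eta x with i |-> val z]; split=> [j /=|].
  by case: eqP => [->|_]; first exact: PX.
rewrite setD1K // in hxz; apply: eq_nwise_free hxz => j _ /=.
by rewrite [in RHS]fun_if.
Qed.

End Representatives.
End NwiseFree.

Section Homogeneous.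
Variables (F : nzRingType) (V : lmodType F).

Definition homog (y : V) : F^o * V := (1, y).

Lemma sum_scale_homog (s : seq V) (c : V -> F) :
  \sum_(y <- s) c y *: homog y = (\sum_(y <- s) c y, \sum_(y <- s) c y *: y).
Proof.
elim/big_rec3: _ => // y u a b _ ->.
by congr (_, _); rewrite /= /GRing.scale /= mulr1.
Qed.

End Homogeneous.

Section GeneralPosition.
Variables (R : realType) (d : nat).
Local Notation point := 'rV[R]_d.
Local Notation homog := (@homog R point).

Lemma affinely_independentE (S : {fset point}) :
  affinely_independent S <-> free (map homog S).
Proof.
rewrite (free_mapP _ (fset_uniq S)); split=> indepS c.
  by rewrite sum_scale_homog => -[]; apply: indepS.
by move=> c0 cy0; apply: indepS; rewrite sum_scale_homog c0 cy0.
Qed.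

Lemma general_position_rangeE (I : finType) (x : I -> point) : injective x ->
  general_position (range x) <-> nwise_free d.+1 (homog \o x) setT.
Proof.
move=> x_inj.
have permJ (J : {set I}) : perm_eq [fset x i | i in J]%fset (map x (enum J)).
  apply: perm_trans (enum_imfset _ (in2W x_inj)) _; apply: perm_map.
  by apply: uniq_perm => [||i]; rewrite ?enum_finmemE ?mem_enum //
    ?enum_finmem_uniq ?enum_uniq.
have cardJ (J : {set I}) : #|` [fset x i | i in J]%fset| = #|J|.
  by rewrite (perm_size (permJ J)) size_map -cardE.
have freeJ (J : {set I}) :
    free (image (homog \o x) J) <->
    affinely_independent [fset x i | i in J]%fset.
  rewrite affinely_independentE /image_mem map_comp.
  by rewrite (perm_free (perm_map homog (permJ J))).
split=> [gx J _ leJ | fx S /= Sx leS].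
  apply/freeJ; apply: gx; rewrite ?cardJ //.
  by move=> _ /= /imfsetP[i _ ->]; exists i.
have SE : S = [fset x i | i in [set i | x i \in S]]%fset.
  apply/fsetP => y; apply/idP/imfsetP => [yS|[i /= + ->]]; last by rewrite inE.
  by have [i _ xi] := Sx y yS; exists i; rewrite /= ?inE xi.
by rewrite SE; apply/freeJ/fx; rewrite ?subsetT // -cardJ -SE.
Qed.

Lemma phi_attained (X : {fset point}) : exists Y : {fset point},
  [/\ (Y `<=` X)%fset, general_position [set` Y]%classic & #|` Y| = phi X].
Proof.
rewrite /phi big_seq_cond; apply: (big_ind (fun n => exists Y : {fset point},
    [/\ (Y `<=` X)%fset, general_position [set` Y]%classic & #|` Y| = n])).
- exists fset0; split; rewrite ?fsub0set ?cardfs0 // => S S0 _ c _ _ x.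
  by move=> /(S0 x) /=; rewrite in_fset0.
- by move=> a b; case: (leqP a b).
- move=> Y /andP[]; rewrite fpowersetE => YX /asboolP gY.
  by exists Y.
Qed.

End GeneralPosition.

Theorem theorem2p2 (R : realType) (d : nat) (hd : (1 <= d)%N) (m : nat)
    (X : 'I_m -> {fset 'rV[R]_d})
    (hX : forall I : {set 'I_m}, I != finset.set0 ->
       (gpB d #|I| <= phi (\bigcup_(i in I) X i)%fset)%N) :
  has_gp_representatives X.
Proof.
have [K K0|x [xX free_x]] := @exists_nwise_free_representatives
    _ _ d _ (@homog R 'rV[R]_d) _ X _ setT.
  have [Y [YX gpY cardY]] := phi_attained (\bigcup_(i in K) X i)%fset.
  exists Y; split; rewrite ?cardY ?hX //.
  apply/(general_position_rangeE val_inj) => S SY.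
  by apply: gpY => _ /SY[z _ <-]; apply: valP.
have x_inj : injective x.
  by move=> i j xij; apply: (nwise_free_inj _ free_x); rewrite ?inE //= xij.
by exists x; split=> //; apply/general_position_rangeE.
Qed.
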